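(* Let $G$ be a simple regular graph on $n$ vertices with adjacency matrix $M$, and let $f$ be a perfect coloring of $G$ with parameter matrix $S$. Then for all $l\in\mathbb N$ (positive integers) and all vertices $u,v\in V(G)$, $$d([M^l]^u,[M^l]^v)\ \ge\ d([S^l]^{f(u)},[S^l]^{f(v)}).$$
   Context: A simple graph is undirected, without loops or multiple edges; its adjacency matrix $M$ is a symmetric $(0,1)$-matrix with zero diagonal. A perfect coloring of $G$ with parameter matrix $S=(s_{i,j})$ of order $k$ is a map $f:V(G)\to\{1,\dots,k\}$ such that every vertex $u$ with $f(u)=i$ has exactly $s_{i,j}$ neighbors of color $j$, for all colors $i,j$. $M^l$ and $S^l$ are ordinary matrix powers. $[A]^i$ denotes the $i$-th row of a square matrix $A$. For real tuples $x,y$ of the same length, $d(x,y)=\sum_i|x_i-y_i|$ is the $L_1$ distance. *)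

(* Defs.v *)
From mathcomp Require Import all_boot all_order all_algebra.

Set Implicit Arguments.
Unset Strict Implicit.
Unset Printing Implicit Defensive.

Import Order.TTheory GRing.Theory Num.Theory.
Local Open Scope ring_scope.

Record simple_graph (n : nat) := SimpleGraph {
  adj :> rel 'I_n;
  adj_sym : symmetric adj;
  adj_irrefl : irreflexive adj
}.

Definition regular_graph (n : nat) (G : simple_graph n) : Prop :=
  exists r : nat, forall u : 'I_n, #|[set v | G u v]| = r.

Definition adj_mx (R : realFieldType) (n : nat) (G : simple_graph n) :
    'M[R]_n :=
  \matrix_(u, v) (G u v)%:R.

(* [f] need not be surjective: rows of [S] indexed by unused colors are
   unconstrained. *)
Definition perfect_coloring (R : realFieldType) (n k : nat)
    (G : simple_graph n) (f : 'I_n -> 'I_k) (S : 'M[R]_k) : Prop :=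
  forall (u : 'I_n) (j : 'I_k), #|[set v | G u v & f v == j]|%:R = S (f u) j.

Definition L1dist (R : realFieldType) (m : nat) (x y : 'rV[R]_m) : R :=
  \sum_i `|x 0 i - y 0 i|.

(* Main.v *)
(* If P is the vertex-by-color incidence matrix of f, perfectness says
   M P = P S, so M^l P = P S^l: the row of S^l at f(u) is the row of M^l at u
   summed over color classes. Such grouping of coordinates does not increase
   the L1 distance, by the triangle inequality. *)
Require Import Defs.
From mathcomp Require Import all_boot all_order all_algebra.

Set Implicit Arguments.
Unset Strict Implicit.
Unset Printing Implicit Defensive.

Import Order.TTheory GRing.Theory Num.Theory.
Local Open Scope ring_scope.

Definition color_mx (R : pzSemiRingType) (n k : nat) (f : 'I_n -> 'I_k) :
    'M[R]_(n, k) :=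
  \matrix_(u, j) (f u == j)%:R.

(** Row [u] of [color_mx R f] is the unit vector at [f u]. *)
Lemma row_color_mx (R : pzSemiRingType) (n k p : nat) (f : 'I_n -> 'I_k)
    (A : 'M[R]_(k, p)) (u : 'I_n) (j : 'I_p) :
  (color_mx R f *m A) u j = A (f u) j.
Proof.
rewrite mxE (bigD1 (f u)) //= mxE eqxx mul1r big1 ?addr0 // => i ne_i.
by rewrite mxE eq_sym (negPf ne_i) mul0r.
Qed.

Lemma adj_mx_color_mx (R : realFieldType) (n k : nat) (G : simple_graph n)
    (f : 'I_n -> 'I_k) (S : 'M[R]_k) :
  perfect_coloring G f S -> adj_mx R G *m color_mx R f = color_mx R f *m S.
Proof.
(* Both entries at [(u, j)] count the neighbors of [u] of color [j], the left one as a sum of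
   products of two indicators. *)
move=> fS; apply/matrixP => u j; rewrite row_color_mx -fS mxE -sum1dep_card.
rewrite natr_sum [RHS]big_mkcond /=; apply: eq_bigr => w _.
by rewrite !mxE; case: (G u w); case: (f w == j); rewrite ?(mulr1, mulr0).
Qed.

Lemma intertwine_expr (R : pzSemiRingType) (n k : nat) (A : 'M[R]_n)
    (B : 'M[R]_k) (P : 'M[R]_(n, k)) (l : nat) :
  A *m P = P *m B -> A ^+ l *m P = P *m B ^+ l.
Proof.
move=> AP; elim: l => [|l IHl]; first by rewrite !expr0 mul1mx mulmx1.
by rewrite !exprSr -!mulmxE -mulmxA AP mulmxA IHl mulmxA.
Qed.

Lemma L1dist_color_mx (R : realFieldType) (n k : nat) (f : 'I_n -> 'I_k)
    (x y : 'rV[R]_n) :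
  L1dist (x *m color_mx R f) (y *m color_mx R f) <= L1dist x y.
Proof.
(* Each [w] has exactly one color, so the distance splits over color classes and the two sides can
   be compared color by color. *)
have -> : L1dist x y = \sum_j \sum_w `|x 0 w - y 0 w| * color_mx R f w j.
  rewrite exchange_big; apply: eq_bigr => w _ /=.
  rewrite (bigD1 (f w)) //= mxE eqxx mulr1 big1 ?addr0 // => j ne_j.
  by rewrite mxE eq_sym (negPf ne_j) mulr0.
apply: ler_sum => j _; rewrite !mxE -sumrB.
apply: le_trans (ler_norm_sum _ _ _) _; apply: ler_sum => w _.
(* The 0/1 weight is nonnegative, so it leaves the absolute value unchanged. *)
by rewrite -mulrBl normrM mxE normr_nat.
Qed.

Theorem theorem4 (R : realFieldType) (n k : nat) (G : simple_graph n)
    (f : 'I_n -> 'I_k) (S : 'M[R]_k)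
    (Greg : regular_graph G) (fS : perfect_coloring G f S)
    (l : nat) (l_gt0 : (0 < l)%N) (u v : 'I_n) :
  L1dist (row u (adj_mx R G ^+ l)) (row v (adj_mx R G ^+ l)) >=
  L1dist (row (f u) (S ^+ l)) (row (f v) (S ^+ l)).
Proof.
have rowE w : row (f w) (S ^+ l) = row w (adj_mx R G ^+ l) *m color_mx R f.
  apply/rowP => j; rewrite -row_mul.
  by rewrite (intertwine_expr l (adj_mx_color_mx fS)) !mxE -row_color_mx mxE.
by rewrite !rowE; apply: L1dist_color_mx.
Qed.
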